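(* Consider the fixed-design linear model with privileged information described in the context. Assume that $X^\top X$ is invertible, and that $A^\top A$ and $[X,A]^\top[X,A]$ are almost surely invertible. Then $$\mathbb{E}[\mathcal{R}(\tau_{\text{marg. NO-PI}}(X))] > \mathbb{E}[\mathcal{R}(\tau_{\text{marg. PI}}(X))]$$ if and only if $$\frac1n\|(I-\Pi_x)\mu(X)v^\star\|^2+\frac{\sigma^2 d}{n} > \frac{\sigma^2}{n}\,\|\mathbb{E}[L]\|^2,$$ where $L = XH_{a\perp}+AG_{x\perp}$. Moreover, when $m=1$ (so that $A$ is a column vector), a sufficient condition for $\mathbb{E}[\mathcal{R}(\tau_{\text{marg. NO-PI}}(X))] > \mathbb{E}[\mathcal{R}(\tau_{\text{marg. PI}}(X))]$ is $$\frac1n\|(I-\Pi_x)\mu(X)v^\star\|^2 > \frac{2\sigma^2}{n}\,\mathbb{E}\left[\frac{\|\Pi_xA\|^2+\|A\|^2}{\|(I-\Pi_x)A\|^2}\right]+\frac{\sigma^2 d}{n}.$$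
   Context: Model. Fix $n,d,m\ge 1$, $\sigma>0$, parameters $w^\star\in\mathbb{R}^d$, $v^\star\in\mathbb{R}^m$, a mean function $\mu:\mathbb{R}^d\to\mathbb{R}^m$ and a covariance function $\Sigma$ mapping $\mathbb{R}^d$ to symmetric positive semidefinite $m\times m$ matrices. The design is fixed: $X\in\mathbb{R}^{n\times d}$ is deterministic with rows $x_1^\top,\dots,x_n^\top$, and $\mu(X)\in\mathbb{R}^{n\times m}$ has rows $\mu(x_i)^\top$. The random matrix $A\in\mathbb{R}^{n\times m}$ (privileged information, PI) has independent rows $a_i^\top$ with $a_i\sim\mathcal{N}(\mu(x_i),\Sigma(x_i))$; the noise $\varepsilon\sim\mathcal{N}(0,\sigma^2 I_n)$ is independent of $A$; and the training targets are $y=Xw^\star+Av^\star+\varepsilon\in\mathbb{R}^n$. Notation. $\|\cdot\|$ is the Euclidean norm for vectors and the Frobenius norm for matrices, $\|M\|^2=\mathrm{tr}(M^\top M)$. - $\Pi_x=X(X^\top X)^{-1}X^\top$ and $\Pi_a=A(A^\top A)^{-1}A^\top$. - $X_{a\perp}=(I-\Pi_a)X$ and $A_{x\perp}=(I-\Pi_x)A$. - $H_{a\perp}=(X_{a\perp}^\top X_{a\perp})^{-1}X_{a\perp}^\top\in\mathbb{R}^{d\times n}$ and $G_{x\perp}=(A_{x\perp}^\top A_{x\perp})^{-1}A_{x\perp}^\top\in\mathbb{R}^{m\times n}$. Risk. For a predictor $\tau(X)\in\mathbb{R}^n$ built from the training quantities, let $y'=Xw^\star+A'v^\star+\varepsilon'$,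 where $(A',\varepsilon')$ is an independent copy of $(A,\varepsilon)$ (same $X$), and define $$\mathcal{R}(\tau(X))=\mathbb{E}_{A',\varepsilon'}\Big[\tfrac1n\|y'-\tau(X)\|^2\Big].$$ $\mathbb{E}[\mathcal{R}(\tau(X))]$ denotes the further expectation over the training quantities $(A,\varepsilon)$; unsubscripted $\mathbb{E}$ is the expectation over the training quantities. Predictors. Let $\hat w_0=(X^\top X)^{-1}X^\top y$ be the ordinary least-squares estimate ignoring $A$, and let $(\hat w_1,\hat v_1)$ be the minimizer of $\frac12\|y-Xw-Av\|^2$ over $(w,v)\in\mathbb{R}^d\times\mathbb{R}^m$. Write $\mathbb{E}_A$ for the expectation over $A$ only, with $\varepsilon$ held fixed (note that $y$ depends on $A$). - $\tau_{\text{marg. NO-PI}}(X)=\mathbb{E}_A[X\hat w_0]$. - $\tau_{\text{marg. PI}}(X)=\mathbb{E}_A[X\hat w_1+A\hat v_1]$. *)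

(* Defs.v *)
From HB Require Import structures.
From mathcomp Require Import all_boot all_order all_algebra.
From mathcomp Require Import all_classical all_reals all_analysis.

Set Implicit Arguments.
Unset Strict Implicit.
Unset Printing Implicit Defensive.

Import Order.TTheory GRing.Theory Num.Theory.
Import numFieldNormedType.Exports.

Local Open Scope classical_set_scope.
Local Open Scope ring_scope.

Section LinearAlgebra.
Context {R : realType}.

(* ||M||^2, Euclidean for column vectors and Frobenius for matrices. *)
Definition sqnorm {k l : nat} (M : 'M[R]_(k, l)) : R := \tr (M^T *m M).

Definition sym_psd {k : nat} (S : 'M[R]_k) : Prop :=
  S^T = S /\ forall t : 'cV[R]_k, 0 <= (t^T *m S *m t) 0 0.

(* invmx M is M itself when M is singular; the formulas below are only
   meaningful when Z^T Z is invertible. *)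
Definition lsinv {k l : nat} (Z : 'M[R]_(k, l)) : 'M[R]_(l, k) :=
  invmx (Z^T *m Z) *m Z^T.

Definition proj_col {k l : nat} (Z : 'M[R]_(k, l)) : 'M[R]_k := Z *m lsinv Z.

(* resid Z W = (I - Pi_Z) W, so that X_{a perp} = resid A X. *)
Definition resid {k l p : nat} (Z : 'M[R]_(k, l)) (W : 'M[R]_(k, p)) :
    'M[R]_(k, p) :=
  (1%:M - proj_col Z) *m W.

Definition Hperp {n d m : nat} (X : 'M[R]_(n, d)) (A : 'M[R]_(n, m)) :
    'M[R]_(d, n) :=
  lsinv (resid A X).

Definition Gperp {n d m : nat} (X : 'M[R]_(n, d)) (A : 'M[R]_(n, m)) :
    'M[R]_(m, n) :=
  lsinv (resid X A).

Definition Lmx {n d m : nat} (X : 'M[R]_(n, d)) (A : 'M[R]_(n, m)) : 'M[R]_n :=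
  X *m Hperp X A + A *m Gperp X A.

Definition mean_mx {n d m : nat} (mu : 'cV[R]_d -> 'cV[R]_m)
    (X : 'M[R]_(n, d)) : 'M[R]_(n, m) :=
  \matrix_(i < n, j < m) mu (row i X)^T j 0.

Definition response {n d m : nat} (X : 'M[R]_(n, d)) (w : 'cV[R]_d)
    (v : 'cV[R]_m) (A : 'M[R]_(n, m)) (e : 'cV[R]_n) : 'cV[R]_n :=
  X *m w + A *m v + e.

Definition w0_hat {n d : nat} (X : 'M[R]_(n, d)) (y : 'cV[R]_n) : 'cV[R]_d :=
  lsinv X *m y.

Definition ls_obj {n d m : nat} (X : 'M[R]_(n, d)) (A : 'M[R]_(n, m))
    (y : 'cV[R]_n) (p : 'cV[R]_d * 'cV[R]_m) : R :=
  2^-1 * sqnorm (y - X *m p.1 - A *m p.2).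

(* The pair (w1_hat, v1_hat): the unique minimizer of the joint least-squares
   objective.  The value (0, 0) is a placeholder for the case where there is no
   unique minimizer, i.e. where [X, A]^T [X, A] is singular. *)
Definition wv1_hat {n d m : nat} (X : 'M[R]_(n, d)) (A : 'M[R]_(n, m))
    (y : 'cV[R]_n) : 'cV[R]_d * 'cV[R]_m :=
  xget (0, 0)
    [set p | forall q, q <> p -> ls_obj X A y p < ls_obj X A y q].

End LinearAlgebra.

Section Probability.
Context {R : realType} {dO : measure_display} {Omega : measurableType dO}.
Variable P : probability Omega R.

(* The univariate law N(a, v) with mean a and variance v >= 0.  The library's
   normal_prob takes the standard deviation and is not the Dirac mass when that
   is 0. *)
Definition gauss_law (a v : R) (B : set R) : \bar R :=
  if v == 0 then \d_a B else normal_prob a (Num.sqrt v) B.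

(* Z ~ N(a, S): Z is a random vector all of whose linear functionals are
   (possibly degenerate) univariate Gaussians. *)
Definition gaussian_vector {k : nat} (Z : Omega -> 'cV[R]_k)
    (a : 'cV[R]_k) (S : 'M[R]_k) : Prop :=
  (forall i, measurable_fun [set: Omega] (fun o => Z o i 0)) /\
  forall (t : 'cV[R]_k) (B : set R), measurable B ->
    P ((fun o => (t^T *m Z o) 0 0) @^-1` B) =
    gauss_law ((t^T *m a) 0 0) ((t^T *m S *m t) 0 0) B.

(* The Borel sigma-algebra of R^(k x l), generated by the coordinates. *)
Definition borel_mx (k l : nat) : set (set 'M[R]_(k, l)) :=
  <<s [set B | exists (i : 'I_k) (j : 'I_l) (C : set R),
         measurable C /\ B = (fun M : 'M[R]_(k, l) => M i j) @^-1` C] >>.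

(* Mutual independence of the rows; the product rule for subfamilies is the
   case where some of the B i are the whole space. *)
Definition rows_independent {n m : nat} (A : Omega -> 'M[R]_(n, m)) : Prop :=
  forall B : 'I_n -> set 'cV[R]_m, (forall i, borel_mx (B i)) ->
    P (\bigcap_(i in [set: 'I_n]) ((fun o => (row i (A o))^T) @^-1` B i)) =
    (\prod_(i < n) P ((fun o => (row i (A o))^T) @^-1` B i))%E.

Definition independent_mx {k l k' l' : nat} (U : Omega -> 'M[R]_(k, l))
    (V : Omega -> 'M[R]_(k', l')) : Prop :=
  forall (B : set 'M[R]_(k, l)) (C : set 'M[R]_(k', l')),
    borel_mx B -> borel_mx C ->
    P (U @^-1` B `&` V @^-1` C) = (P (U @^-1` B) * P (V @^-1` C))%E.

Definition expect_mx {k l : nat} (M : Omega -> 'M[R]_(k, l)) : 'M[R]_(k, l) :=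
  \matrix_(i, j) fine 'E_P[fun o => M o i j].

Context {n d m : nat} (X : 'M[R]_(n, d)) (wst : 'cV[R]_d) (vst : 'cV[R]_m)
  (A : Omega -> 'M[R]_(n, m)) (eps : Omega -> 'cV[R]_n).

(* The marginalized predictors as functions of the noise vector e, which is
   held fixed while the expectation is taken over A. *)
Definition tau_marg_nopi (e : 'cV[R]_n) : 'cV[R]_n :=
  expect_mx (fun o => X *m w0_hat X (response X wst vst (A o) e)).

Definition tau_marg_pi (e : 'cV[R]_n) : 'cV[R]_n :=
  expect_mx (fun o =>
    let wv := wv1_hat X (A o) (response X wst vst (A o) e) in
    X *m wv.1 + A o *m wv.2).

(* The risk of a fixed prediction vector tau.  The fresh pair (A', eps') is
   (A o', eps o') at a second sample point o' drawn from P, so that the iterated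
   integral in expected_risk makes it an independent copy of the training pair. *)
Definition risk (tau : 'cV[R]_n) : \bar R :=
  'E_P[fun o' => n%:R^-1 * sqnorm (response X wst vst (A o') (eps o') - tau)].

Definition expected_risk (tau : 'cV[R]_n -> 'cV[R]_n) : \bar R :=
  (\int[P]_o risk (tau (eps o)))%E.

End Probability.

(* Main.v *)
(* Where [X, A]^T [X, A] is invertible, L = X H + A G is the orthogonal
   projection onto the range of [X, A] (Frisch-Waugh-Lovell), so its entries are
   bounded, L X = X, L A = A and ||L||^2 = d + m.  Hence both marginalized
   predictors are affine in the noise: writing M = mu(X),
     tau_NO-PI(e) = X w* + Pi_x M v* + Pi_x e  and
     tau_PI(e) = X w* + M v* + E[L] e.
   For tau(e) = c + B e, the bias-variance decomposition gives
   n E[R(tau)] = K + ||X w* + M v* - c||^2 + sigma^2 ||B||^2, where K does not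
   depend on tau, and ||Pi_x||^2 = d yields the equivalence.  For m = 1, Jensen's
   inequality gives ||E[L]||^2 <= E ||L||^2 = d + 1, while the ratio in the
   sufficient condition is at least 1 almost surely. *)

Require Import Defs.
From HB Require Import structures.
From mathcomp Require Import all_boot all_order all_algebra.
From mathcomp Require Import all_classical all_reals all_analysis.
From mathcomp Require Import measurable_realfun.
From mathcomp Require Import ring lra.

Set Implicit Arguments.
Unset Strict Implicit.
Unset Printing Implicit Defensive.

Import Order.TTheory GRing.Theory Num.Theory.
Import numFieldNormedType.Exports.

Local Open Scope classical_set_scope.
Local Open Scope ring_scope.

(** * Moments of the normal law *)

Section NormalMoments.
Context {R : realType}.
Implicit Types a s t c : R.

(** The Radon-Nikodym derivative of the normal law and [normal_pdf] have the same integral over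
    every measurable set, hence agree almost everywhere. *)
Lemma ge0_integral_normal_prob a s (f : R -> \bar R) :
  measurable_fun [set: R] f -> (forall x, 0 <= f x)%E ->
  (\int[normal_prob a s]_x f x =
   \int[lebesgue_measure]_x (f x * (normal_pdf a s x)%:E))%E.
Proof.
move=> mf f0; have dom := @normal_prob_dominates R a s.
rewrite -(Radon_Nikodym_SigmaFinite.change_of_variables dom)//.
have mrn : measurable_fun [set: R]
    (Radon_Nikodym_SigmaFinite.f (normal_prob a s) lebesgue_measure).
  exact: measurable_int (Radon_Nikodym_SigmaFinite.f_integrable dom).
have mpdf : measurable_fun [set: R] (EFin \o normal_pdf a s).
  by apply/measurable_EFinP; exact: measurable_normal_pdf.
apply: ae_eq_integral => //; [exact: emeasurable_funM|exact: emeasurable_funM|].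
apply: ae_eqe_mul2l; apply: integral_ae_eq => //.
  exact: Radon_Nikodym_SigmaFinite.f_integrable.
by move=> E _ mE; rewrite -Radon_Nikodym_SigmaFinite.f_integral.
Qed.

(** Completing the square: exp(t (x - a)) times the density of N(a, s^2) is the claimed constant
    times the density of N(a + t s^2, s^2), whose total mass is 1. *)
Lemma integral_normal_expR a s t : s != 0 ->
  (\int[normal_prob a s]_x (expR (t * (x - a)))%:E =
   (expR (t ^+ 2 * s ^+ 2 / 2))%:E)%E.
Proof.
move=> s0; rewrite ge0_integral_normal_prob; first last.
- by move=> x; rewrite lee_fin expR_ge0.
- apply/measurable_EFinP; apply: measurableT_comp => //.
  by apply: measurable_funM => //; exact: measurable_funB.
rewrite -[RHS]mule1 -(integral_normal_pdf (a + t * s ^+ 2) s).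
rewrite -(integralZl measurableT (integrable_normal_pdf _ _)).
apply: eq_integral => x _; rewrite -!EFinM !normal_pdfE//.
rewrite mulrCA [in RHS]mulrCA -!expRD; congr (_ * expR _)%:E.
by field.
Qed.

(** With q = 1 + 2 c s^2, the extra factor rescales the standard deviation to s / sqrt q, and the
    ratio of the two normalizing constants is q^(-1/2). The rate [c] may be negative. *)
Lemma integral_normal_expR_sqr a s c : s != 0 -> 0 < 1 + 2 * c * s ^+ 2 ->
  (\int[normal_prob a s]_x (expR (- c * (x - a) ^+ 2))%:E =
   ((Num.sqrt (1 + 2 * c * s ^+ 2))^-1)%:E)%E.
Proof.
move=> s0 q0; set q := 1 + _ in q0 *.
rewrite ge0_integral_normal_prob; first last.
- by move=> x; rewrite lee_fin expR_ge0.
- apply/measurable_EFinP; apply: measurableT_comp => //.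
  apply: measurable_funM => //; apply: measurable_funX.
  exact: measurable_funB.
have r0 : Num.sqrt q != 0 by rewrite gt_eqF// sqrtr_gt0.
have r2 : Num.sqrt q ^+ 2 = q by rewrite sqr_sqrtr// ltW.
pose s' := s / Num.sqrt q.
have s'0 : s' != 0 by rewrite mulf_neq0// invr_neq0.
have s'2 : s' ^+ 2 = s ^+ 2 / q by rewrite exprMn exprVn r2.
have peakE : normal_peak s = (Num.sqrt q)^-1 * normal_peak s'.
  rewrite /normal_peak s'2 -invfM; congr (_^-1).
  rewrite -sqrtrM ?ltW//; congr Num.sqrt.
  by field; rewrite gt_eqF.
rewrite -[RHS]mule1 -(integral_normal_pdf a s').
rewrite -(integralZl measurableT (integrable_normal_pdf _ _)).
apply: eq_integral => x _; rewrite -!EFinM !normal_pdfE// peakE.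
rewrite mulrCA !mulrA; congr (_ %:E); rewrite -!mulrA; congr (_ * (_ * _)).
rewrite -!expRD; congr expR; rewrite s'2 /q.
by field; rewrite s0 /= (gt_eqF q0).
Qed.

Lemma quadratic_le0 (p q r e : R) : 0 < e ->
  (forall t, 0 < t -> t < e -> p + t * q + t ^+ 2 * r <= 0) -> p <= 0.
Proof.
move=> e0 H; rewrite leNgt; apply/negP => p0.
pose B := `|q| + `|r| + 1.
have B0 : 0 < B by rewrite ltr_wpDl// addr_ge0.
(* This [t] is so small that |t q + t^2 r| <= t (|q| + |r|) <= p / 2, which keeps p + t q + t^2 r
   positive. *)
pose t := Num.min (e / 2) (Num.min 1 (p / (2 * B))).
have t0 : 0 < t by rewrite !lt_min ltr01 !divr_gt0// mulr_gt0.
have te : t < e.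
  rewrite (@le_lt_trans _ _ (e / 2)) ?ge_min ?lexx//.
  by rewrite ltr_pdivrMr// ltr_pMr// ltr1n.
have t1 : t <= 1 by rewrite !ge_min lexx orbT.
have tB : t * B <= p / 2.
  have : t <= p / (2 * B) by rewrite !ge_min lexx !orbT.
  by rewrite ler_pdivlMr ?mulr_gt0//; lra.
have tq : - (t * `|q|) <= t * q.
  by rewrite -mulrN ler_pM2l// lerNl ler_normr lexx orbT.
have tr : - (t * `|r|) <= t ^+ 2 * r.
  apply: (@le_trans _ _ (- (t ^+ 2 * `|r|))).
    by rewrite lerN2 expr2 -mulrA ler_pM2l// ler_piMl.
  by rewrite -mulrN ler_pM2l ?exprn_gt0// lerNl ler_normr lexx orbT.
have := H t t0 te; rewrite /B in tB; lra.
Qed.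

(** First-order condition: a cubic that vanishes at 0 and is nonpositive around 0 has slope 0 there.
    It extracts moments from exponential inequalities without differentiating under the integral. *)
Lemma tangent_eq0 (p q r e : R) : 0 < e ->
  (forall t, `|t| < e -> t * (p + t * q + t ^+ 2 * r) <= 0) -> p = 0.
Proof.
move=> e0 H; apply/eqP; rewrite eq_le -oppr_le0; apply/andP; split.
  apply: (quadratic_le0 (q := q) (r := r) e0) => t t0 te.
  by have := H t; rewrite gtr0_norm// pmulr_rle0//; exact.
apply: (quadratic_le0 (q := q) (r := - r) e0) => t t0 te.
have := H (- t); rewrite normrN gtr0_norm// => /(_ te).
by rewrite mulNr -mulrN pmulr_rle0// sqrrN; lra.
Qed.

End NormalMoments.

(** * Integrability and expectation of real random variables *)

Section RealExpectation.
Context {R : realType} {d : measure_display} {T : measurableType d}.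
Variable P : probability T R.
Implicit Types f g : T -> R.

Local Notation integ f := (P.-integrable [set: T] (EFin \o f)).

Lemma integ_cst (c : R) : integ (fun=> c).
Proof. exact: finite_measure_integrable_cst. Qed.

Lemma integD f g : integ f -> integ g -> integ (fun x => f x + g x).
Proof. exact: integrableD. Qed.

Lemma integZl (c : R) f : integ f -> integ (fun x => c * f x).
Proof. exact: integrableZl. Qed.

Lemma integ_sum (I : Type) (r : seq I) (f : I -> T -> R) :
  (forall i, integ (f i)) -> integ (fun x => \sum_(i <- r) f i x).
Proof.
move=> fi; elim: r => [|i r IH].
  by under eq_fun do rewrite big_nil; exact: integ_cst.
by under eq_fun do rewrite big_cons; exact: integD.
Qed.

Lemma le_integ f g : measurable_fun [set: T] f ->
  (forall x, `|f x| <= g x) -> integ g -> integ f.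
Proof.
move=> mf fg; apply: le_integrable => //; first exact/measurable_EFinP.
by move=> x _ /=; rewrite lee_fin (le_trans (fg x))// ler_norm.
Qed.

Lemma Rexp_cst (c : R) : (\int[P]_x c = c)%R.
Proof. by rewrite Rintegral_cst//= probability_setT/= mulr1. Qed.

Lemma Rexp_sum (I : Type) (r : seq I) (f : I -> T -> R) :
  (forall i, integ (f i)) ->
  (\int[P]_x (\sum_(i <- r) f i x) = \sum_(i <- r) \int[P]_x f i x)%R.
Proof.
move=> fi; elim: r => [|i r IH].
  by under eq_Rintegral do rewrite big_nil; rewrite Rexp_cst big_nil.
under eq_Rintegral do rewrite big_cons.
by rewrite RintegralD// ?big_cons ?IH//; exact: integ_sum.
Qed.

Lemma Rexp_EFin f : integ f ->
  (\int[P]_x (f x)%:E = (\int[P]_x f x)%R%:E)%E.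
Proof. by move=> fi; rewrite /Rintegral fineK//; exact: integrable_fin_num. Qed.

End RealExpectation.

(** * Mean and variance of a possibly degenerate Gaussian variable *)

Section GaussianVariable.
Context {R : realType} {d : measure_display} {T : measurableType d}.
Variable P : probability T R.

Local Notation integ f := (P.-integrable [set: T] (EFin \o f)).

Section nondegenerate.
Variables (a s : R) (U : T -> R).
Hypothesis s0 : s != 0.
Hypothesis mU : measurable_fun [set: T] U.
Hypothesis lawU : forall B : set R, measurable B ->
  P (U @^-1` B) = normal_prob a s B.

Let mUa : measurable_fun [set: T] (fun x => U x - a).
Proof. exact: measurable_funB. Qed.

Let ge0_integral_law (f : R -> \bar R) :
  measurable_fun [set: R] f -> (forall x, 0 <= f x)%E ->
  (\int[P]_x f (U x) = \int[normal_prob a s]_x f x)%E.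
Proof.
move=> mf f0.
have mU' : measurable_fun [set: T] (U : T -> measurableTypeR R) := mU.
have mf' : measurable_fun [set: measurableTypeR R] f := mf.
have := ge0_integral_pushforward mU' P measurableT mf'.
rewrite preimage_setT => /(_ (fun x _ => f0 x)) <-.
by apply: eq_measure_integral => B mB _; exact: lawU.
Qed.

Let integral_expR t : (\int[P]_x (expR (t * (U x - a)))%:E =
  (expR (t ^+ 2 * s ^+ 2 / 2))%:E)%E.
Proof.
rewrite -(integral_normal_expR a t s0) -ge0_integral_law//.
apply/measurable_EFinP; apply: measurableT_comp => //.
by apply: measurable_funM => //; exact: measurable_funB.
Qed.

Let integral_expR_sqr c : 0 < 1 + 2 * c * s ^+ 2 ->
  (\int[P]_x (expR (- c * (U x - a) ^+ 2))%:E =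
   ((Num.sqrt (1 + 2 * c * s ^+ 2))^-1)%:E)%E.
Proof.
move=> c0; rewrite -(integral_normal_expR_sqr a s0 c0) -ge0_integral_law//.
apply/measurable_EFinP; apply: measurableT_comp => //.
by apply: measurable_funM => //; apply: measurable_funX; exact: measurable_funB.
Qed.

Let integ_expR t : integ (fun x => expR (t * (U x - a))).
Proof.
apply/integrableP; split.
  by apply/measurable_EFinP; apply: measurableT_comp => //; exact: measurable_funM.
under eq_integral do rewrite /= ger0_norm ?expR_ge0//.
by rewrite integral_expR ltry.
Qed.

Let integ_expR_sqr c : 0 < 1 + 2 * c * s ^+ 2 ->
  integ (fun x => expR (- c * (U x - a) ^+ 2)).
Proof.
move=> c0; apply/integrableP; split.
  apply/measurable_EFinP; apply: measurableT_comp => //.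
  by apply: measurable_funM => //; exact: measurable_funX.
under eq_integral do rewrite /= ger0_norm ?expR_ge0//.
by rewrite integral_expR_sqr// ltry.
Qed.

(** Domination by |z| <= exp(z) + exp(-z), a consequence of 1 + z <= exp(z). *)
Let integ_centered : integ (fun x => U x - a).
Proof.
apply: (le_integ mUa _ (integD (integ_expR 1) (integ_expR (-1)))) => x.
rewrite mul1r mulN1r.
have := expR_ge1Dx (U x - a); have := expR_ge1Dx (- (U x - a)).
have := expR_ge0 (U x - a); have := expR_ge0 (- (U x - a)).
by case: (leP 0 (U x - a)) => h; [rewrite ger0_norm|rewrite ltr0_norm]; lra.
Qed.

Let s20 : 0 < s ^+ 2. Proof. by rewrite exprn_even_gt0. Qed.

Let integ_centered_sqr : integ (fun x => (U x - a) ^+ 2).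
Proof.
(* At this rate 1 - 2 c s^2 = 1/2 > 0, so exp(c z^2) is integrable, and it dominates c z^2. *)
pose c := (4 * s ^+ 2)^-1.
have c0 : 0 < c by rewrite invr_gt0 mulr_gt0.
have q0 : 0 < 1 + 2 * (- c) * s ^+ 2.
  have -> : 2 * - c * s ^+ 2 = - 2^-1 by rewrite /c; field.
  lra.
apply: (le_integ _ _ (integZl c^-1 (integ_expR_sqr q0))) => [|x].
  exact: measurable_funX.
rewrite ger0_norm ?sqr_ge0// mulrC ler_pdivlMr// opprK mulrC.
have := expR_ge1Dx (c * (U x - a) ^+ 2); lra.
Qed.

(* 1 + t M <= E exp(t (U - a)) = exp(t^2 s^2 / 2) for every real t makes the
   line 1 + t M tangent at 0 to the right-hand side. *)
Let Rexp_centered : (\int[P]_x (U x - a) = 0)%R.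
Proof.
set M := (\int[_]_x _)%R; pose c := s ^+ 2 / 2.
have c0 : 0 < c by rewrite divr_gt0.
have H t : 1 + t * M <= expR (t ^+ 2 * c).
  have -> : expR (t ^+ 2 * c) = (\int[P]_x (expR (t * (U x - a))))%R.
    by rewrite /Rintegral integral_expR mulrA.
  have -> : 1 + t * M = (\int[P]_x (1 + t * (U x - a)))%R.
    by rewrite RintegralD ?Rexp_cst ?RintegralZl//; [exact: integ_cst|exact: integZl].
  apply: le_Rintegral => //.
  - by apply: integD; [exact: integ_cst|exact: integZl].
  - by move=> x _; exact: expR_ge1Dx.
(* Within this radius 1 + t M >= 0, so 1 - t^2 c <= exp(- t^2 c) may be multiplied by it. *)
have e0 : 0 < (1 + `|M|)^-1 by rewrite invr_gt0 ltr_wpDr.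
apply: (tangent_eq0 (q := - c) (r := - (M * c)) e0) => t te.
have tM : 0 <= 1 + t * M.
  rewrite -lerBlDl sub0r lerNl (le_trans (ler_norm _))// normrN normrM.
  move: te; rewrite -[X in _ < X]mul1r ltr_pdivlMr ?ltr_wpDr// => te.
  by rewrite (le_trans _ (ltW te))// ler_wpM2l// lerDr.
have := H t; have := expR_ge1Dx (- (t ^+ 2 * c)); rewrite expRN => h1 h2.
(* Expanding the product gives t (M - t c - t^2 M c) <= 0, the form that [tangent_eq0] expects. *)
suff : (1 + t * M) * (1 - t ^+ 2 * c) <= 1 by lra.
apply: (@le_trans _ _ ((1 + t * M) * (expR (t ^+ 2 * c))^-1)).
  exact: ler_wpM2l.
by rewrite ler_pdivrMr ?expR_gt0// mul1r.
Qed.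

(* As above, now with E exp(- t (U - a)^2) = (1 + 2 t s^2)^(-1/2). *)
Let Rexp_centered_sqr : (\int[P]_x ((U x - a) ^+ 2) = s ^+ 2)%R.
Proof.
set M := (\int[_]_x _)%R.
have M0 : 0 <= M by apply: Rintegral_ge0 => x _; exact: sqr_ge0.
(* The radius keeps 1 + 2 t s^2 positive, as the Gaussian integral requires, and 1 - t M
   nonnegative, so that the bound on it can be squared. *)
have e0 : 0 < (1 + M + 2 * s ^+ 2)^-1.
  by rewrite invr_gt0; have := s20; lra.
suff : 2 * (s ^+ 2 - M) = 0.
  by move/eqP; rewrite mulf_eq0 pnatr_eq0/= subr_eq0 => /eqP.
apply: (tangent_eq0 (q := M ^+ 2 - 4 * M * s ^+ 2)
  (r := 2 * M ^+ 2 * s ^+ 2) e0) => t te.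
have {}te : `|t| * (1 + M + 2 * s ^+ 2) < 1.
  by move: te; rewrite -[X in _ < X]mul1r ltr_pdivlMr// -invr_gt0.
have t0 := normr_ge0 t; have tt := ler_norm t.
have tt' : - t <= `|t| by rewrite -normrN ler_norm.
have tM : t * M <= `|t| * M by exact: ler_wpM2r.
have ts : - (2 * t * s ^+ 2) <= `|t| * (2 * s ^+ 2).
  have -> : - (2 * t * s ^+ 2) = - t * (2 * s ^+ 2) by ring.
  by rewrite ler_wpM2r// mulr_ge0// ltW.
have tM0 : 0 <= `|t| * M by rewrite mulr_ge0.
have ts0 : 0 <= `|t| * (2 * s ^+ 2) by rewrite mulr_ge0// mulr_ge0// ltW.
have q0 : 0 < 1 + 2 * t * s ^+ 2 by lra.
have p0 : 0 <= 1 - t * M by lra.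
have H : 1 - t * M <= (Num.sqrt (1 + 2 * t * s ^+ 2))^-1.
  have -> : (Num.sqrt (1 + 2 * t * s ^+ 2))^-1 =
      (\int[P]_x (expR (- t * (U x - a) ^+ 2)))%R.
    by rewrite /Rintegral integral_expR_sqr.
  have -> : 1 - t * M = (\int[P]_x (1 + - t * (U x - a) ^+ 2))%R.
    rewrite RintegralD ?Rexp_cst ?RintegralZl ?mulNr//.
      exact: integ_cst.
    exact: integZl.
  apply: le_Rintegral => //.
  - by apply: integD; [exact: integ_cst|exact: integZl].
  - exact: integ_expR_sqr.
  - by move=> x _; exact: expR_ge1Dx.
(* Squaring removes the root; the left-hand side minus 1 is t times the quadratic whose coefficients
   were given to [tangent_eq0]. *)
suff : (1 - t * M) ^+ 2 * (1 + 2 * t * s ^+ 2) <= 1 by lra.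
rewrite -ler_pdivlMr// div1r.
rewrite -[X in _ <= X^-1](sqr_sqrtr (ltW q0)) -exprVn.
by rewrite ler_sqr ?nnegrE ?invr_ge0.
Qed.

Lemma normal_moments : [/\ integ U, integ (fun x => U x ^+ 2),
  (\int[P]_x U x = a)%R & (\int[P]_x (U x - a) ^+ 2 = s ^+ 2)%R].
Proof.
have UE : U = (fun x => (U x - a) + a) by apply/funext => x; rewrite subrK.
have iU : integ U.
  by rewrite UE; apply: integD => //; exact: integ_cst.
split=> //.
- rewrite (_ : (fun x => U x ^+ 2) =
    (fun x => ((U x - a) ^+ 2 + (2 * a) * U x) + (- a ^+ 2))).
    by apply: integD; [apply: integD => //; exact: integZl|exact: integ_cst].
  by apply/funext => x; ring.
- rewrite {1}UE RintegralD ?Rexp_cst ?Rexp_centered ?add0r//.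
  exact: integ_cst.
Qed.

End nondegenerate.

Lemma gauss_law_moments (a v : R) (U : T -> R) : 0 <= v ->
    measurable_fun [set: T] U ->
    (forall B : set R, measurable B -> P (U @^-1` B) = gauss_law a v B) ->
  [/\ integ U, integ (fun x => U x ^+ 2),
    (\int[P]_x U x = a)%R & (\int[P]_x (U x - a) ^+ 2 = v)%R].
Proof.
move=> v0 mU lawU; have [vz|vn] := eqVneq v 0.
  (* Under a Dirac law [U] equals [a] almost surely, so each measurable function of [U] is almost
     surely constant. *)
  have ae_const (f : R -> R) : measurable_fun [set: R] f ->
      integ (f \o U) /\ (\int[P]_x f (U x) = f a)%R.
    move=> mf; have mfU : measurable_fun [set: T] (f \o U).
      exact: measurableT_comp.
    have ae : ae_eq P setT (EFin \o (f \o U)) (EFin \o cst (f a)).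
      exists (U @^-1` [set~ a]); split => //.
      - by rewrite -[X in measurable X]setTI; apply: mU => //; apply: measurableC.
      - have := lawU _ (measurableC (measurable_set1 a)).
        by rewrite /gauss_law vz eqxx diracE memNset//=; exact.
      - by move=> x /= h Ux; apply: h => _; rewrite Ux.
    split; last first.
      rewrite -[RHS](Rexp_cst P) /Rintegral; congr fine.
      by apply: ae_eq_integral ae => //; exact/measurable_EFinP.
    apply/integrableP; split; first exact/measurable_EFinP.
    rewrite (ae_eq_integral (fun=> `|f a|%:E)) => [||||]//.
    - by rewrite integral_cst//= probability_setT/= mule1 ltry.
    - by apply/measurableT_comp => //; exact/measurable_EFinP.
    - by apply: filterS ae => x h _; have /= [->] := h I.
  have [i1 e1] := ae_const id (@measurable_id _ _ _).
  have [i2 _] := ae_const (fun x => x ^+ 2) (measurable_funX 2 (@measurable_id _ _ _)).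
  have [|_ e2] := ae_const (fun x => (x - a) ^+ 2).
    by apply: measurable_funX; exact: measurable_funB.
  by split => //; rewrite e2 vz subrr expr0n.
have s0 : Num.sqrt v != 0 by rewrite gt_eqF// sqrtr_gt0 lt_def vn.
rewrite -[in X in [/\ _, _, _ & X]](sqr_sqrtr v0); apply: normal_moments => // B mB.
by rewrite lawU// /gauss_law (negbTE vn).
Qed.

End GaussianVariable.

(** * Partialled-out least squares *)

Section LeastSquares.
Context {R : realType}.

Lemma sqnormE k l (M : 'M[R]_(k, l)) : sqnorm M = \sum_i \sum_j M i j ^+ 2.
Proof.
rewrite /sqnorm /mxtrace exchange_big/=; apply: eq_bigr => j _.
by rewrite !mxE; apply: eq_bigr => i _; rewrite !mxE expr2.
Qed.

Lemma sqnorm_ge0 k l (M : 'M[R]_(k, l)) : 0 <= sqnorm M.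
Proof.
by rewrite sqnormE sumr_ge0// => i _; rewrite sumr_ge0// => j _; rewrite sqr_ge0.
Qed.

Lemma sqnorm_eq0 k l (M : 'M[R]_(k, l)) : (sqnorm M == 0) = (M == 0).
Proof.
apply/eqP/eqP => [|->]; last by rewrite /sqnorm mulmx0 mxtrace0.
rewrite sqnormE => /eqP; rewrite psumr_eq0; last first.
  by move=> i _; rewrite sumr_ge0// => j _; rewrite sqr_ge0.
move=> /allP M0; apply/matrixP => i j; rewrite mxE.
have := M0 i (mem_index_enum _); rewrite /= psumr_eq0; last first.
  by move=> ? _; rewrite sqr_ge0.
by move=> /allP/(_ j (mem_index_enum _)); rewrite /= sqrf_eq0 => /eqP.
Qed.

Lemma sqnormN k l (M : 'M[R]_(k, l)) : sqnorm (- M) = sqnorm M.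
Proof.
rewrite !sqnormE; apply: eq_bigr => i _; apply: eq_bigr => j _.
by rewrite mxE sqrrN.
Qed.

Lemma sqnormD_orth k l (M N : 'M[R]_(k, l)) : M^T *m N = 0 ->
  sqnorm (M + N) = sqnorm M + sqnorm N.
Proof.
move=> MN; rewrite /sqnorm [(M + N)^T]raddfD/= mulmxDl !mulmxDr MN addr0.
by rewrite -[N^T *m M]trmxK trmx_mul trmxK MN trmx0 add0r mxtraceD.
Qed.

(** A row [r] in the kernel of the Gram matrix satisfies ||Z r^T||^2 = r Z^T Z r^T = 0, so
    injectivity of [Z] forces r = 0. *)
Lemma gram_unitP k l (Z : 'M[R]_(k, l)) :
  reflect (forall u : 'cV[R]_l, Z *m u = 0 -> u = 0) (Z^T *m Z \in unitmx).
Proof.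
apply: (iffP idP) => [ZU u Zu|inj].
  by rewrite -[u](mulKmx ZU) -mulmxA Zu !mulmx0.
rewrite -row_free_unit -kermx_eq0; apply/eqP/row_matrixP => i.
rewrite row0; set r := row i _.
have r0 : r *m (Z^T *m Z) = 0 by rewrite -row_mul mulmx_ker row0.
apply: trmx_inj; rewrite trmx0; apply: inj; apply/eqP.
rewrite -sqnorm_eq0 /sqnorm trmx_mul trmxK -mulmxA (mulmxA Z^T) mulmxA r0.
by rewrite mul0mx mxtrace0.
Qed.

(** * Orthogonal projection onto a column space *)

Section projection.
Context {k l : nat} (Z : 'M[R]_(k, l)).
Hypothesis ZU : Z^T *m Z \in unitmx.

Lemma lsinv_mul : lsinv Z *m Z = 1%:M.
Proof. by rewrite /lsinv -mulmxA mulVmx. Qed.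

Lemma proj_colK : proj_col Z *m Z = Z.
Proof. by rewrite /proj_col -mulmxA lsinv_mul mulmx1. Qed.

Lemma tr_proj_col : (proj_col Z)^T = proj_col Z.
Proof.
by rewrite /proj_col /lsinv !trmx_mul trmxK trmx_inv trmx_mul trmxK mulmxA.
Qed.

Lemma proj_col_idem : proj_col Z *m proj_col Z = proj_col Z.
Proof. by rewrite {2 3}/proj_col mulmxA proj_colK. Qed.

Lemma tr_mul_proj_col : Z^T *m proj_col Z = Z^T.
Proof. by rewrite -[RHS](congr1 trmx proj_colK) trmx_mul tr_proj_col. Qed.

Lemma sqnorm_proj_col : sqnorm (proj_col Z) = l%:R.
Proof.
by rewrite /sqnorm tr_proj_col proj_col_idem mxtrace_mulC lsinv_mul mxtrace1.
Qed.

(** I - Pi_Z is symmetric and idempotent, so one of its two occurrences is redundant. *)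
Lemma tr_resid_mul p q (W : 'M[R]_(k, p)) (V : 'M[R]_(k, q)) :
  (resid Z W)^T *m resid Z V = W^T *m resid Z V.
Proof.
rewrite /resid trmx_mul [(_ - _)^T]raddfB/= trmx1 tr_proj_col -mulmxA; congr (_ *m _).
rewrite mulmxA; congr (_ *m _).
by rewrite mulmxBl mul1mx mulmxBr mulmx1 proj_col_idem subrr subr0.
Qed.

Lemma sqnorm_split p (W : 'M[R]_(k, p)) :
  sqnorm W = sqnorm (proj_col Z *m W) + sqnorm (resid Z W).
Proof.
rewrite -sqnormD_orth; last first.
  rewrite /resid trmx_mul tr_proj_col -mulmxA (mulmxA (proj_col Z)).
  by rewrite mulmxBr mulmx1 proj_col_idem subrr mul0mx mulmx0.
by rewrite /resid -mulmxDl addrC subrK mul1mx.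
Qed.

End projection.

(** * The coefficient block of one regressor group after removing the other *)

Section partialled_out.
Context {n d m : nat} (X : 'M[R]_(n, d)) (A : 'M[R]_(n, m)).
Hypothesis ZU : (row_mx X A)^T *m row_mx X A \in unitmx.

(** Since [Hperp X A] is [Gperp A X] by definition, this symmetry transfers every fact about [Gperp]
    to [Hperp]. *)
Lemma gram_row_mxC : (row_mx A X)^T *m row_mx A X \in unitmx.
Proof.
apply/gram_unitP => u; rewrite -[u]vsubmxK mul_row_col => Zu.
have /gram_unitP/(_ (col_mx (dsubmx u) (usubmx u))) := ZU.
rewrite mul_row_col addrC => /(_ Zu)/eqP.
by rewrite col_mx_eq0 => /andP[/eqP -> /eqP ->]; rewrite col_mx0.
Qed.

Lemma gram_row_mxl : X^T *m X \in unitmx.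
Proof.
apply/gram_unitP => u Xu.
have /gram_unitP/(_ (col_mx u 0)) := ZU; rewrite mul_row_col Xu mulmx0 addr0.
by move=> /(_ erefl)/eqP; rewrite col_mx_eq0 => /andP[/eqP].
Qed.

(** If (I - Pi_x) A u = 0, then A u lies in the range of X, and (- [lsinv X] A u, u) is a kernel
    vector of [X, A]. *)
Lemma resid_gram_unit : (resid X A)^T *m resid X A \in unitmx.
Proof.
apply/gram_unitP => u; rewrite /resid mulmxBl mul1mx mulmxBl => /eqP.
rewrite subr_eq0 => /eqP AuE.
have /gram_unitP/(_ (col_mx (- (lsinv X *m A *m u)) u)) := ZU.
rewrite mul_row_col mulmxN AuE /proj_col -!mulmxA addNr => /(_ erefl)/eqP.
by rewrite col_mx_eq0 => /andP[_ /eqP].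
Qed.

Lemma Gperp_mul : Gperp X A *m A = 1%:M.
Proof.
rewrite /Gperp /lsinv -mulmxA -[X in _ *m X](_ : (resid X A)^T *m resid X A = _).
  by rewrite mulVmx// resid_gram_unit.
rewrite (tr_resid_mul gram_row_mxl) /resid trmx_mul [(_ - _)^T]raddfB/= trmx1.
by rewrite tr_proj_col mulmxA.
Qed.

Lemma Gperp_mul0 : Gperp X A *m X = 0.
Proof.
rewrite /Gperp /lsinv -mulmxA [X in _ *m X](_ : _ = 0) ?mulmx0//.
rewrite /resid trmx_mul [(_ - _)^T]raddfB/= trmx1 tr_proj_col -mulmxA.
by rewrite mulmxBl mul1mx proj_colK ?gram_row_mxl// subrr mulmx0.
Qed.

(** The rows of G are combinations of the columns of X and A. With the two preceding products this
    determines G as a block of the pseudo-inverse of [X, A]. *)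
Lemma Gperp_orth p (W : 'M[R]_(n, p)) :
  X^T *m W = 0 -> A^T *m W = 0 -> Gperp X A *m W = 0.
Proof.
move=> XW AW; rewrite /Gperp /lsinv -mulmxA [X in _ *m X](_ : _ = 0) ?mulmx0//.
rewrite /resid trmx_mul [(_ - _)^T]raddfB/= trmx1 -mulmxA mulmxBl mul1mx mulmxBr AW.
by rewrite /proj_col trmx_mul -mulmxA XW !mulmx0 subrr.
Qed.

End partialled_out.

(** * Joint least squares assembled from the partialled-out blocks *)

Section frisch_waugh_lovell.
Context {n d m : nat} (X : 'M[R]_(n, d)) (A : 'M[R]_(n, m)).
Let Z := row_mx X A.
Hypothesis ZU : Z^T *m Z \in unitmx.

Lemma Hperp_mul : Hperp X A *m X = 1%:M.
Proof. exact: (Gperp_mul (gram_row_mxC ZU)). Qed.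

Lemma Hperp_mul0 : Hperp X A *m A = 0.
Proof. exact: (Gperp_mul0 (gram_row_mxC ZU)). Qed.

(** The stacked matrix B is a left inverse of Z that vanishes on the orthogonal complement of its
    range, and this characterizes [lsinv Z]. *)
Lemma lsinv_row_mx : lsinv Z = col_mx (Hperp X A) (Gperp X A).
Proof.
set B := col_mx _ _.
have BZ : B *m Z = 1%:M.
  rewrite mul_col_row Hperp_mul Hperp_mul0 Gperp_mul// Gperp_mul0//.
  by rewrite -scalar_mx_block.
have [XW AW] : X^T *m (1%:M - proj_col Z) = 0 /\ A^T *m (1%:M - proj_col Z) = 0.
  apply: eq_col_mx; rewrite -mul_col_mx -tr_row_mx col_mx0.
  by rewrite mulmxBr mulmx1 tr_mul_proj_col// subrr.
have BW : B *m (1%:M - proj_col Z) = 0.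
  rewrite mul_col_mx (Gperp_orth XW AW) [X in col_mx X _](Gperp_orth AW XW).
  by rewrite col_mx0.
(* B - [lsinv Z] = B - B Z [lsinv Z] = B (I - Pi_Z) = 0. *)
apply/esym/eqP; rewrite -subr_eq0 -[lsinv Z]mul1mx -BZ -mulmxA -/(proj_col Z).
by rewrite -{1}[B]mulmx1 -mulmxBr BW.
Qed.

Lemma LmxE : Lmx X A = proj_col Z.
Proof. by rewrite /proj_col lsinv_row_mx mul_row_col. Qed.

Lemma Lmx_mull : Lmx X A *m X = X.
Proof.
have := proj_colK ZU; rewrite -LmxE mul_mx_row => /eq_row_mx[] //.
Qed.

Lemma Lmx_mulr : Lmx X A *m A = A.
Proof.
have := proj_colK ZU; rewrite -LmxE mul_mx_row => /eq_row_mx[] //.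
Qed.

Lemma sqnorm_Lmx : sqnorm (Lmx X A) = (d + m)%:R.
Proof. by rewrite LmxE sqnorm_proj_col. Qed.

End frisch_waugh_lovell.

(** A crude bound from (|x| - 1)^2 >= 0 that avoids square roots; it suffices to make the entries of
    a projection bounded. *)
Lemma normr_le_sqnorm k l (M : 'M[R]_(k, l)) i j : `|M i j| <= 1 + sqnorm M.
Proof.
have H : M i j ^+ 2 <= sqnorm M.
  rewrite sqnormE (bigD1 i)//= (bigD1 j)//= -addrA lerDl addr_ge0//.
    by rewrite sumr_ge0// => ? _; rewrite sqr_ge0.
  by rewrite sumr_ge0// => ? _; rewrite sumr_ge0// => ? _; rewrite sqr_ge0.
have := sqr_ge0 (`|M i j| - 1); have := sqnorm_ge0 M.
by move: H; rewrite -[M i j ^+ 2](real_normK (num_real _)); lra.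
Qed.

(** * The minimizer of the joint objective *)

Section minimizer.
Context {n d m : nat} (X : 'M[R]_(n, d)) (A : 'M[R]_(n, m)) (y : 'cV[R]_n).
Let Z := row_mx X A.

Lemma ls_objE (p : 'cV[R]_d * 'cV[R]_m) :
  ls_obj X A y p = 2^-1 * sqnorm (y - Z *m col_mx p.1 p.2).
Proof. by rewrite /ls_obj mul_row_col opprD addrA. Qed.

Lemma wv1_hatE : Z^T *m Z \in unitmx ->
  wv1_hat X A y = (Hperp X A *m y, Gperp X A *m y).
Proof.
move=> ZU; set p := (_, _).
have pE : col_mx p.1 p.2 = lsinv Z *m y by rewrite lsinv_row_mx// mul_col_mx.
have pmin q : q <> p -> ls_obj X A y p < ls_obj X A y q.
  move=> qp; rewrite !ls_objE ltr_pM2l ?invr_gt0//.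
  set u := col_mx p.1 p.2; set v := col_mx q.1 q.2.
  (* The residual y - Z u is orthogonal to the range of Z, so moving from u to v costs ||Z (u -
     v)||^2, which is positive because Z is injective. *)
  rewrite -[y - Z *m v](_ : (y - Z *m u) + Z *m (u - v) = _); last first.
    by rewrite mulmxBr addrA subrK.
  rewrite [X in _ < X]sqnormD_orth ?ltrDl ?lt_def ?sqnorm_ge0 ?andbT ?sqnorm_eq0.
    apply/eqP => /(gram_unitP _ ZU)/eqP; rewrite subr_eq0 => /eqP uv.
    by apply: qp; case: q @v uv => q1 q2 /= /eq_col_mx[<- <-].
  rewrite mulmxA (_ : _ *m Z = 0) ?mul0mx//.
  rewrite /u pE mulmxA -/(proj_col Z) -{1}[y]mul1mx -mulmxBl trmx_mul.
  rewrite [(_ - _)^T]raddfB/= trmx1 tr_proj_col -mulmxA mulmxBl mul1mx proj_colK//.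
  by rewrite subrr mulmx0.
apply: xget_unique => //= q qmin; apply/eqP/negPn/negP => /eqP qp.
have pq : p <> q by move=> pq; exact: qp.
by have := lt_trans (pmin _ qp) (qmin _ pq); rewrite ltxx.
Qed.

(** Translating any candidate by a kernel vector of Z leaves the objective unchanged, so none is a
    strict minimizer. Knowing this value makes the fitted prediction an explicit measurable function
    on the whole sample space. *)
Lemma wv1_hat_singular : Z^T *m Z \notin unitmx -> wv1_hat X A y = (0, 0).
Proof.
move=> ZN; apply: xgetPN => p pmin.
have [u Zu u0] : exists2 u : 'cV[R]_(d + m), Z *m u = 0 & u != 0.
  apply: contrapT => nex; move/negP: ZN; apply; apply/gram_unitP => u Zu.
  by apply/eqP/negPn/negP => u0; apply: nex; exists u.
have qp : (p.1 + usubmx u, p.2 + dsubmx u) <> p.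
  rewrite [in X in _ <> X](surjective_pairing p) => -[/eqP e1 /eqP e2].
  move: e1 e2; rewrite -subr_eq0 addrC addKr => /eqP e1.
  rewrite -subr_eq0 addrC addKr => /eqP e2.
  by move: u0; rewrite -[u]vsubmxK e1 e2 col_mx0 eqxx.
have := pmin _ qp.
by rewrite !ls_objE -add_col_mx vsubmxK mulmxDr Zu addr0 ltxx.
Qed.

End minimizer.

End LeastSquares.

(** * Random matrices *)

Section MeasurableMatrix.
Context {R : realType} {dT : measure_display} {T : measurableType dT}.

Definition measurable_mx {k l : nat} (M : T -> 'M[R]_(k, l)) : Prop :=
  forall i j, measurable_fun [set: T] (fun o => M o i j).

(* x^-1 = x * (x^2)^(-1) as real powers, also at x = 0 where both are 0. *)
Lemma measurable_invr (f : T -> R) :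
  measurable_fun [set: T] f -> measurable_fun [set: T] (fun o => (f o)^-1).
Proof.
move=> mf.
rewrite (_ : (fun o => _) = (fun o => f o * ((f o ^+ 2) `^ (-1)))).
  apply: measurable_funM => //; apply: (measurableT_comp (measurable_powR (-1))) => //.
  exact: measurable_funX.
apply/funext => o; have [->|f0] := eqVneq (f o) 0; first by rewrite invr0 mul0r.
by rewrite powR_inv1 ?sqr_ge0// expr2 invfM mulrA divff// mul1r.
Qed.

Lemma measurable_mx_cst k l (M : 'M[R]_(k, l)) : measurable_mx (fun=> M).
Proof. by move=> i j; exact: measurable_cst. Qed.

Lemma measurable_mxD k l (M N : T -> 'M[R]_(k, l)) :
  measurable_mx M -> measurable_mx N -> measurable_mx (fun o => M o + N o).
Proof.
by move=> mM mN i j; under eq_fun do rewrite mxE; exact: measurable_funD.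
Qed.

Lemma measurable_mxN k l (M : T -> 'M[R]_(k, l)) :
  measurable_mx M -> measurable_mx (fun o => - M o).
Proof.
by move=> mM i j; under eq_fun do rewrite mxE; exact: measurableT_comp.
Qed.

Lemma measurable_mxM k l p (M : T -> 'M[R]_(k, l)) (N : T -> 'M[R]_(l, p)) :
  measurable_mx M -> measurable_mx N -> measurable_mx (fun o => M o *m N o).
Proof.
move=> mM mN i j; under eq_fun do rewrite mxE.
by apply: measurable_sum => q; exact: measurable_funM.
Qed.

Lemma measurable_mx_tr k l (M : T -> 'M[R]_(k, l)) :
  measurable_mx M -> measurable_mx (fun o => (M o)^T).
Proof. by move=> mM i j; under eq_fun do rewrite mxE; exact: mM. Qed.

Lemma measurable_mxZ k l (f : T -> R) (M : T -> 'M[R]_(k, l)) :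
  measurable_fun [set: T] f -> measurable_mx M ->
  measurable_mx (fun o => f o *: M o).
Proof.
by move=> mf mM i j; under eq_fun do rewrite mxE; exact: measurable_funM.
Qed.

Lemma measurable_row_mx k l p (M : T -> 'M[R]_(k, l)) (N : T -> 'M[R]_(k, p)) :
  measurable_mx M -> measurable_mx N ->
  measurable_mx (fun o => row_mx (M o) (N o)).
Proof.
move=> mM mN i j; rewrite -[j]fintype.splitK; case: (fintype.split j) => q /=.
  by under eq_fun do rewrite row_mxEl; exact: mM.
by under eq_fun do rewrite row_mxEr; exact: mN.
Qed.

Lemma measurable_mxtrace k (M : T -> 'M[R]_k) :
  measurable_mx M -> measurable_fun [set: T] (fun o => \tr (M o)).
Proof. by move=> mM; apply: measurable_sum => i; exact: mM. Qed.

Lemma measurable_sqnorm k l (M : T -> 'M[R]_(k, l)) :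
  measurable_mx M -> measurable_fun [set: T] (fun o => sqnorm (M o)).
Proof.
move=> mM; apply: measurable_mxtrace; apply: measurable_mxM => //.
exact: measurable_mx_tr.
Qed.

Lemma measurable_det k (M : T -> 'M[R]_k) :
  measurable_mx M -> measurable_fun [set: T] (fun o => \det (M o)).
Proof.
move=> mM; apply: measurable_sum => s.
apply: measurable_funM; first exact: measurable_cst.
by apply: measurable_prod => i _; exact: mM.
Qed.

Lemma measurable_mx_adj k (M : T -> 'M[R]_k) :
  measurable_mx M -> measurable_mx (fun o => \adj (M o)).
Proof.
move=> mM i j; under eq_fun do rewrite mxE.
apply: measurable_funM; first exact: measurable_cst.
by apply: measurable_det => p q; under eq_fun do rewrite !mxE; exact: mM.
Qed.

(** The indicator of invertibility, by the convention that the inverse of 0 is 0; in this algebraic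
    form its measurability follows from that of the determinant. *)
Definition unit_indic {k} (M : 'M[R]_k) : R := \det M * (\det M)^-1.

Lemma unit_indic1 k (M : 'M[R]_k) : M \in unitmx -> unit_indic M = 1.
Proof. by rewrite unitmxE /unit_indic => MU; rewrite mulrV. Qed.

Lemma unit_indic0 k (M : 'M[R]_k) : M \notin unitmx -> unit_indic M = 0.
Proof.
by rewrite unitmxE unitfE negbK /unit_indic => /eqP ->; rewrite mul0r.
Qed.

Lemma measurable_unit_indic k (M : T -> 'M[R]_k) :
  measurable_mx M -> measurable_fun [set: T] (fun o => unit_indic (M o)).
Proof.
move=> mM; apply: measurable_funM; first exact: measurable_det.
by apply: measurable_invr; exact: measurable_det.
Qed.

Lemma measurable_invmx k (M : T -> 'M[R]_k) :
  measurable_mx M -> measurable_mx (fun o => invmx (M o)).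
Proof.
(* The first summand is the cofactor formula and is 0 on singular matrices, where the second
   supplies the default value M of [invmx]. *)
move=> mM; rewrite (_ : (fun o => _) = (fun o =>
    (\det (M o))^-1 *: \adj (M o) + (1 - unit_indic (M o)) *: M o)).
  apply: measurable_mxD; apply: measurable_mxZ => //.
  - by apply: measurable_invr; exact: measurable_det.
  - exact: measurable_mx_adj.
  - by apply: measurable_funB => //; exact: measurable_unit_indic.
apply/funext => o; rewrite /invmx; case: ifPn => MU.
  by rewrite unit_indic1// subrr scale0r addr0.
rewrite unit_indic0// subr0 scale1r; move: MU; rewrite unitmxE unitfE negbK.
by move=> /eqP ->; rewrite invr0 scale0r add0r.
Qed.

Lemma measurable_lsinv k l (Z : T -> 'M[R]_(k, l)) :
  measurable_mx Z -> measurable_mx (fun o => lsinv (Z o)).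
Proof.
move=> mZ; have mZt := measurable_mx_tr mZ.
by apply: measurable_mxM => //; apply: measurable_invmx; exact: measurable_mxM.
Qed.

Lemma measurable_resid k l p (Z : T -> 'M[R]_(k, l)) (W : T -> 'M[R]_(k, p)) :
  measurable_mx Z -> measurable_mx W ->
  measurable_mx (fun o => resid (Z o) (W o)).
Proof.
move=> mZ mW; apply: measurable_mxM => //.
apply: measurable_mxD; first exact: measurable_mx_cst.
apply: measurable_mxN; apply: measurable_mxM => //.
exact: measurable_lsinv.
Qed.

Lemma measurable_Lmx n d m (X : 'M[R]_(n, d)) (A : T -> 'M[R]_(n, m)) :
  measurable_mx A -> measurable_mx (fun o => Lmx X (A o)).
Proof.
move=> mA; have mX := @measurable_mx_cst n d X.
by apply: measurable_mxD; apply: measurable_mxM => //;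
  apply: measurable_lsinv; exact: measurable_resid.
Qed.

End MeasurableMatrix.

(** * Entrywise expectation and second moments of random matrices *)

Section MatrixExpectation.
Context {R : realType} {dT : measure_display} {T : measurableType dT}.
Variable P : probability T R.

Local Notation integ f := (P.-integrable [set: T] (EFin \o f)).

Definition integ_mx {k l : nat} (M : T -> 'M[R]_(k, l)) : Prop :=
  forall i j, integ (fun o => M o i j).

Lemma expect_mxE k l (M : T -> 'M[R]_(k, l)) i j :
  expect_mx P M i j = (\int[P]_o M o i j)%R.
Proof. by rewrite mxE unlock. Qed.

Lemma integ_mx_cst k l (M : 'M[R]_(k, l)) : integ_mx (fun=> M).
Proof. by move=> i j; exact: integ_cst. Qed.

Lemma integ_mxD k l (M N : T -> 'M[R]_(k, l)) :
  integ_mx M -> integ_mx N -> integ_mx (fun o => M o + N o).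
Proof. by move=> iM iN i j; under eq_fun do rewrite mxE; exact: integD. Qed.

Lemma integ_mxMl k l p (M : 'M[R]_(k, l)) (N : T -> 'M[R]_(l, p)) :
  integ_mx N -> integ_mx (fun o => M *m N o).
Proof.
move=> iN i j; under eq_fun do rewrite mxE.
by apply: integ_sum => q; exact: integZl.
Qed.

Lemma integ_mxMr k l p (M : T -> 'M[R]_(k, l)) (N : 'M[R]_(l, p)) :
  integ_mx M -> integ_mx (fun o => M o *m N).
Proof.
move=> iM i j; under eq_fun do rewrite mxE.
by apply: integ_sum => q; under eq_fun do rewrite mulrC; exact: integZl.
Qed.

Lemma expect_mx_cst k l (M : 'M[R]_(k, l)) : expect_mx P (fun=> M) = M.
Proof. by apply/matrixP => i j; rewrite expect_mxE Rexp_cst. Qed.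

Lemma expect_mxD k l (M N : T -> 'M[R]_(k, l)) :
  integ_mx M -> integ_mx N ->
  expect_mx P (fun o => M o + N o) = expect_mx P M + expect_mx P N.
Proof.
move=> iM iN; apply/matrixP => i j; rewrite expect_mxE [RHS]mxE !expect_mxE.
by under eq_Rintegral do rewrite mxE; exact: RintegralD.
Qed.

Lemma expect_mxMl k l p (M : 'M[R]_(k, l)) (N : T -> 'M[R]_(l, p)) :
  integ_mx N -> expect_mx P (fun o => M *m N o) = M *m expect_mx P N.
Proof.
move=> iN; apply/matrixP => i j; rewrite expect_mxE mxE.
under eq_Rintegral do rewrite mxE.
rewrite Rexp_sum => [|q]; last exact: integZl.
by apply: eq_bigr => q _; rewrite expect_mxE RintegralZl.
Qed.

Lemma expect_mxMr k l p (M : T -> 'M[R]_(k, l)) (N : 'M[R]_(l, p)) :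
  integ_mx M -> expect_mx P (fun o => M o *m N) = expect_mx P M *m N.
Proof.
move=> iM; apply/matrixP => i j; rewrite expect_mxE mxE.
under eq_Rintegral do rewrite mxE.
rewrite Rexp_sum => [|q]; last first.
  by under eq_fun do rewrite mulrC; exact: integZl.
apply: eq_bigr => q _; rewrite expect_mxE -RintegralZr//.
Qed.

Lemma ae_eq_expect_mx k l (M N : T -> 'M[R]_(k, l)) :
  measurable_mx M -> measurable_mx N -> {ae P, forall o, M o = N o} ->
  expect_mx P M = expect_mx P N.
Proof.
move=> mM mN MN; apply/matrixP => i j; rewrite !expect_mxE.
rewrite /Rintegral; congr fine; apply: ae_eq_integral => //.
- by apply/measurable_EFinP; exact: mM.
- by apply/measurable_EFinP; exact: mN.
- by apply: filterS MN => o -> _.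
Qed.

Lemma integ_sqr_centered (f : T -> R) (c : R) :
  integ f -> integ (fun o => f o ^+ 2) -> integ (fun o => (f o - c) ^+ 2).
Proof.
move=> i1 i2.
rewrite (_ : (fun o => _) = (fun o => f o ^+ 2 + (- (2 * c) * f o + c ^+ 2))).
  by apply: integD => //; apply: integD; [exact: integZl|exact: integ_cst].
by apply/funext => o; ring.
Qed.

(** Scalar bias-variance decomposition: the cross term 2 (c - t) (f - c) has mean zero. *)
Lemma Rexp_sqrB (f : T -> R) (c t : R) :
  integ f -> integ (fun o => f o ^+ 2) -> (\int[P]_o f o = c)%R ->
  (\int[P]_o (f o - t) ^+ 2 = \int[P]_o (f o - c) ^+ 2 + (c - t) ^+ 2)%R.
Proof.
move=> i1 i2 ec.
have i3 := integ_sqr_centered c i1 i2.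
have E o : (f o - t) ^+ 2 = (f o - c) ^+ 2 +
    (2 * (c - t) * f o + ((c - t) ^+ 2 - 2 * (c - t) * c)) by ring.
under eq_Rintegral do rewrite E.
have i4 : integ (fun o => 2 * (c - t) * f o) by exact: integZl.
have i5 (r : R) : integ (fun=> r) by exact: integ_cst.
rewrite RintegralD//; last exact: integD.
by rewrite RintegralD// Rexp_cst RintegralZl// ec; ring.
Qed.

(** Domination by (f + g)^2 <= 2 (f^2 + g^2). *)
Lemma integ_sqrD (f g : T -> R) :
  measurable_fun [set: T] f -> measurable_fun [set: T] g ->
  integ (fun o => f o ^+ 2) -> integ (fun o => g o ^+ 2) ->
  integ (fun o => (f o + g o) ^+ 2).
Proof.
move=> mf mg i1 i2.
apply: (le_integ _ _ (integZl 2 (integD i1 i2))) => [|o].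
  by apply: measurable_funX; exact: measurable_funD.
rewrite ger0_norm ?sqr_ge0//; have := sqr_ge0 (f o - g o); lra.
Qed.

(** Jensen for the square: the gap is the variance, read off the decomposition at t = 0. *)
Lemma sqr_Rexp_le (f : T -> R) : integ f -> integ (fun o => f o ^+ 2) ->
  ((\int[P]_o f o) ^+ 2 <= \int[P]_o (f o ^+ 2))%R.
Proof.
move=> i1 i2; have := Rexp_sqrB 0 i1 i2 erefl.
under eq_Rintegral do rewrite subr0.
by rewrite subr0 => ->; rewrite lerDr Rintegral_ge0// => o _; exact: sqr_ge0.
Qed.

Section sqnorm.
Context {k : nat} (Y : T -> 'cV[R]_k) (y0 : 'cV[R]_k).
Hypothesis iY : integ_mx Y.
Hypothesis iY2 : forall i, integ (fun o => Y o i 0 ^+ 2).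
Hypothesis EY : expect_mx P Y = y0.

Let sqnormBE t : (fun o => sqnorm (Y o - t)) =
  (fun o => \sum_i (Y o i 0 - t i 0) ^+ 2).
Proof.
apply/funext => o; rewrite sqnormE; apply: eq_bigr => i _.
by rewrite big_ord1 !mxE.
Qed.

Lemma integ_sqnormB t : integ (fun o => sqnorm (Y o - t)).
Proof.
by rewrite sqnormBE; apply: integ_sum => i; exact: integ_sqr_centered.
Qed.

Lemma Rexp_sqnormB t : (\int[P]_o sqnorm (Y o - t) =
  (\sum_i \int[P]_o (Y o i 0 - y0 i 0) ^+ 2) + sqnorm (y0 - t))%R.
Proof.
rewrite sqnormBE Rexp_sum => [|i]; last exact: integ_sqr_centered.
rewrite sqnormE -big_split/=; apply: eq_bigr => i _.
rewrite big_ord1 !mxE; apply: Rexp_sqrB => //.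
by rewrite -EY expect_mxE.
Qed.

End sqnorm.

Lemma gaussian_vector_moments k (Z : T -> 'cV[R]_k) (a : 'cV[R]_k)
    (S : 'M[R]_k) (t : 'cV[R]_k) : gaussian_vector P Z a S -> sym_psd S ->
  let U o := (t^T *m Z o) 0 0 in let c := (t^T *m a) 0 0 in
  [/\ integ U, integ (fun o => U o ^+ 2), (\int[P]_o U o = c)%R &
    (\int[P]_o (U o - c) ^+ 2 = (t^T *m S *m t) 0 0)%R].
Proof.
move=> [mZ lawZ] [_ psdS] U c; apply: gauss_law_moments => //.
  apply: (@measurable_mxM _ _ _ _ _ _ (fun=> t^T) Z) => [|i j].
    exact: measurable_mx_cst.
  by rewrite ord1; exact: mZ.
by move=> B mB; exact: lawZ.
Qed.

End MatrixExpectation.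

(** * Expected risks *)

Section Risk.
Context {R : realType} {dO : measure_display} {Omega : measurableType dO}.
Variable P : probability Omega R.
Context {n d m : nat} (sigma : R) (X : 'M[R]_(n, d)) (wst : 'cV[R]_d)
  (vst : 'cV[R]_m) (mu : 'cV[R]_d -> 'cV[R]_m) (Sigma : 'cV[R]_d -> 'M[R]_m)
  (A : Omega -> 'M[R]_(n, m)) (eps : Omega -> 'cV[R]_n).
Hypothesis hSigma : forall x, sym_psd (Sigma x).
Hypothesis hA : forall i : 'I_n, gaussian_vector P (fun o => (row i (A o))^T)
  (mu (row i X)^T) (Sigma (row i X)^T).
Hypothesis heps : gaussian_vector P eps 0 ((sigma ^+ 2)%:M).

Local Notation integ f := (P.-integrable [set: Omega] (EFin \o f)).

Let meanA := mean_mx mu X.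

Let psd_eps : sym_psd ((sigma ^+ 2)%:M : 'M[R]_n).
Proof.
split=> [|t]; first by rewrite tr_scalar_mx.
by rewrite mul_mx_scalar -scalemxAl mxE mulr_ge0 ?sqr_ge0//
  -[_ 0 0]trace_mx11; exact: sqnorm_ge0.
Qed.

Lemma row_mulE (v : 'cV[R]_m) o i :
  (v^T *m (row i (A o))^T) 0 0 = (A o *m v) i 0.
Proof. by rewrite -trmx_mul mxE -row_mul mxE. Qed.

Lemma measurable_mx_PI : measurable_mx A.
Proof.
move=> i j; have := (hA i).1 j.
by under eq_fun do rewrite !mxE.
Qed.

Lemma measurable_mx_noise : measurable_mx eps.
Proof. by move=> i j; rewrite ord1; exact: heps.1. Qed.

Lemma PI_moments (v : 'cV[R]_m) i :
  [/\ integ (fun o => (A o *m v) i 0), integ (fun o => (A o *m v) i 0 ^+ 2) &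
    (\int[P]_o (A o *m v) i 0 = (meanA *m v) i 0)%R].
Proof.
have [i1 i2 e1 _] := gaussian_vector_moments v (hA i) (hSigma _).
split; [by move: i1; under eq_fun do rewrite row_mulE| |].
  by move: i2; under eq_fun do rewrite row_mulE.
under eq_Rintegral do rewrite -row_mulE.
rewrite e1 !mxE; apply: eq_bigr => j _.
rewrite !mxE mulrC; congr (_ * _).
Qed.

Lemma noise_moments (t : 'cV[R]_n) :
  [/\ integ (fun o => (t^T *m eps o) 0 0),
    integ (fun o => (t^T *m eps o) 0 0 ^+ 2),
    (\int[P]_o (t^T *m eps o) 0 0 = 0)%R &
    (\int[P]_o (t^T *m eps o) 0 0 ^+ 2 = sigma ^+ 2 * sqnorm t)%R].
Proof.
have [i1 i2] := gaussian_vector_moments t heps psd_eps.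
rewrite mulmx0 mxE => e1; under eq_Rintegral do rewrite subr0.
move=> e2; split => //; rewrite e2 mul_mx_scalar -scalemxAl mxE.
by rewrite -[_ 0 0]trace_mx11.
Qed.

Lemma integ_mx_PI : integ_mx P A.
Proof.
move=> i j; have [+ _ _] := PI_moments (delta_mx j 0) i.
by under eq_fun do rewrite -colE mxE.
Qed.

Lemma expect_mx_PI : expect_mx P A = meanA.
Proof.
apply/matrixP => i j; have [_ _] := PI_moments (delta_mx j 0) i.
by under eq_Rintegral do rewrite -colE mxE; rewrite -colE mxE expect_mxE.
Qed.

Lemma integ_mx_noise : integ_mx P eps.
Proof.
move=> i j; have [+ _ _ _] := noise_moments (delta_mx i 0).
by under eq_fun do rewrite trmx_delta -rowE mxE; rewrite ord1.
Qed.

Lemma expect_mx_noise : expect_mx P eps = 0.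
Proof.
apply/matrixP => i j; have [_ _ + _] := noise_moments (delta_mx i 0).
under eq_Rintegral do rewrite trmx_delta -rowE mxE.
by rewrite ord1 expect_mxE mxE.
Qed.

Let Y o := response X wst vst (A o) (eps o).
Let y0 := X *m wst + meanA *m vst.

Lemma integ_mx_response : integ_mx P Y.
Proof.
apply: integ_mxD; last exact: integ_mx_noise.
apply: integ_mxD; first exact: integ_mx_cst.
exact/integ_mxMr/integ_mx_PI.
Qed.

Lemma expect_mx_response : expect_mx P Y = y0.
Proof.
have iA := integ_mx_PI; have iAv := @integ_mxMr _ _ _ P _ _ _ _ vst iA.
have iXw := @integ_mx_cst _ _ _ P _ _ (X *m wst).
rewrite expect_mxD ?expect_mx_noise ?addr0; last exact: integ_mx_noise.
  by rewrite expect_mxD// expect_mx_cst expect_mxMr// expect_mx_PI.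
exact: integ_mxD.
Qed.

Lemma integ_response_sqr i : integ (fun o => Y o i 0 ^+ 2).
Proof.
have mA := measurable_mx_PI; have mXw := @measurable_mx_cst _ _ Omega _ _ (X *m wst).
have mv := @measurable_mx_cst _ _ Omega _ _ vst.
have mAv := measurable_mxM mA mv.
have [_ iAv _] := PI_moments vst i.
under eq_fun do rewrite [Y _ i 0]mxE.
apply: integ_sqrD.
- exact: (measurable_mxD mXw mAv).
- exact: measurable_mx_noise.
- under eq_fun do rewrite [(X *m wst + _) i 0]mxE.
  by apply: integ_sqrD => //; exact: integ_cst.
- have [_ + _ _] := noise_moments (delta_mx i 0).
  by under eq_fun do rewrite trmx_delta -rowE mxE.
Qed.

(** The total variance of the response, since [y0] is its mean. It is left unevaluated because it
    cancels when two risks are compared. *)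
Definition noise_floor : R := (\sum_i \int[P]_o (Y o i 0 - y0 i 0) ^+ 2)%R.

Lemma riskE (tau : 'cV[R]_n) : risk P X wst vst A eps tau =
  (n%:R^-1 * (noise_floor + sqnorm (y0 - tau)))%:E.
Proof.
have i1 := integ_mx_response; have i2 := integ_response_sqr.
have iS := integ_sqnormB i1 i2 tau.
rewrite /risk unlock Rexp_EFin; last exact: integZl.
by rewrite RintegralZl// (Rexp_sqnormB i1 i2 expect_mx_response).
Qed.

(** The bias-variance decomposition is used twice: for the fresh response inside [riskE], then for
    the centered training vector M eps against the target b = y0 - c. *)
Lemma expected_risk_affine (tau : 'cV[R]_n -> 'cV[R]_n) (c : 'cV[R]_n)
    (M : 'M[R]_n) : (forall e, tau e = c + M *m e) ->
  expected_risk P X wst vst A eps tau =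
  (n%:R^-1 * (noise_floor + (sqnorm (y0 - c) + sigma ^+ 2 * sqnorm M)))%:E.
Proof.
move=> tauE; pose b := y0 - c.
have riskME o : risk P X wst vst A eps (tau (eps o)) =
    (n%:R^-1 * (noise_floor + sqnorm (M *m eps o - b)))%:E.
  by rewrite riskE tauE opprD addrA -/b -sqnormN opprB.
have i1 : integ_mx P (fun o => M *m eps o) by exact/integ_mxMl/integ_mx_noise.
have i2 i : integ (fun o => (M *m eps o) i 0 ^+ 2).
  have [_ + _ _] := noise_moments (row i M)^T.
  by under eq_fun do rewrite trmxK -row_mul mxE.
have E0 : expect_mx P (fun o => M *m eps o) = 0.
  by rewrite expect_mxMl ?expect_mx_noise ?mulmx0//; exact: integ_mx_noise.
have iS := integ_sqnormB i1 i2 b.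
rewrite /expected_risk.
under eq_integral do rewrite riskME.
rewrite Rexp_EFin; last by apply: integZl; apply: integD => //; exact: integ_cst.
rewrite RintegralZl//; last by apply: integD => //; exact: integ_cst.
rewrite RintegralD//; last exact: integ_cst.
rewrite Rexp_cst (Rexp_sqnormB i1 i2 E0) sub0r; congr (_ * (_ + _))%:E.
rewrite addrC; congr (_ + _).
  by rewrite sqnormN.
(* Coordinate i of M eps is the functional of the noise given by row i of M, with variance sigma^2
   ||row i M||^2. *)
rewrite sqnormE mulr_sumr; apply: eq_bigr => i _.
have [_ _ _] := noise_moments (row i M)^T.
under eq_Rintegral do rewrite trmxK -row_mul mxE.
under [in X in _ -> X]eq_Rintegral do rewrite [(0 : 'cV[R]_n) i 0]mxE subr0.
move=> ->; rewrite sqnormE; congr (_ * _).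
by apply: eq_bigr => j _; rewrite big_ord1 !mxE.
Qed.

Lemma integ_mx_signal : integ_mx P (fun o => X *m wst + A o *m vst).
Proof.
apply: integ_mxD; first exact: integ_mx_cst.
exact/integ_mxMr/integ_mx_PI.
Qed.

Lemma expect_mx_signal : expect_mx P (fun o => X *m wst + A o *m vst) = y0.
Proof.
rewrite expect_mxD; first last.
- exact/integ_mxMr/integ_mx_PI.
- exact: integ_mx_cst.
by rewrite expect_mx_cst expect_mxMr ?expect_mx_PI//; exact: integ_mx_PI.
Qed.

Lemma tau_marg_nopiE : X^T *m X \in unitmx -> forall e,
  tau_marg_nopi P X wst vst A e =
  X *m wst + proj_col X *m (meanA *m vst) + proj_col X *m e.
Proof.
move=> XU e; rewrite /tau_marg_nopi.
rewrite (_ : (fun o => _) =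
    (fun o => proj_col X *m ((X *m wst + A o *m vst) + e))); last first.
  by apply/funext => o; rewrite /w0_hat mulmxA.
have iS := integ_mx_signal; have ie := @integ_mx_cst _ _ _ P _ _ e.
rewrite expect_mxMl; last exact: integ_mxD.
rewrite expect_mxD// expect_mx_signal expect_mx_cst /y0 !mulmxDr mulmxA.
by rewrite proj_colK.
Qed.

Hypothesis hXA : {ae P, forall o,
  (row_mx X (A o))^T *m row_mx X (A o) \in unitmx}.

(* Lmx is a projection, hence bounded, only where [X, A]^T [X, A] is
   invertible; N agrees with it there and is 0 elsewhere. *)
Let ind o : R := unit_indic ((row_mx X (A o))^T *m row_mx X (A o)).
Let N o : 'M[R]_n := ind o *: Lmx X (A o).

Let mind : measurable_fun [set: Omega] ind.
Proof.
have mZ := measurable_row_mx (@measurable_mx_cst _ _ Omega _ _ X) measurable_mx_PI.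
apply: measurable_unit_indic; apply: measurable_mxM => //.
exact: measurable_mx_tr.
Qed.

Let mN : measurable_mx N.
Proof.
by apply: measurable_mxZ => //; apply: measurable_Lmx; exact: measurable_mx_PI.
Qed.

Let sqnormN_le o : sqnorm (N o) <= (d + m)%:R.
Proof.
rewrite /N /ind; have [ZU|ZN] := boolP
  ((row_mx X (A o))^T *m row_mx X (A o) \in unitmx).
  by rewrite unit_indic1// scale1r sqnorm_Lmx.
rewrite unit_indic0// scale0r (_ : sqnorm 0 = 0) ?ler0n//.
by apply/eqP; rewrite sqnorm_eq0.
Qed.

Let iN : integ_mx P N.
Proof.
move=> i j; apply: (@le_integ _ _ _ _ _ (fun=> 1 + (d + m)%:R)) => [||].
- exact: mN.
- by move=> o; rewrite (le_trans (normr_le_sqnorm (N o) i j))// lerD2l.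
- exact: integ_cst.
Qed.

Let expect_mx_N : expect_mx P N = expect_mx P (fun o => Lmx X (A o)).
Proof.
apply: ae_eq_expect_mx => //; first exact/measurable_Lmx/measurable_mx_PI.
by apply: filterS hXA => o ZU; rewrite /N /ind unit_indic1// scale1r.
Qed.

(** Almost surely the fitted vector is L y, and L fixes X w* + A v*; only the noise is transformed
    by L. *)
Lemma tau_marg_piE e : tau_marg_pi P X wst vst A e =
  y0 + expect_mx P (fun o => Lmx X (A o)) *m e.
Proof.
have mA := measurable_mx_PI.
have iS := integ_mx_signal; have iNe := integ_mxMr e iN.
have mS : measurable_mx (fun o => X *m wst + A o *m vst).
  apply: measurable_mxD; first exact: measurable_mx_cst.
  by apply: measurable_mxM => //; exact: measurable_mx_cst.
have mNe : measurable_mx (fun o => N o *m e).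
  by apply: measurable_mxM => //; exact: measurable_mx_cst.
rewrite -expect_mx_N -(expect_mxMr e iN) -expect_mx_signal -(expect_mxD iS iNe).
(* This rewriting holds at every sample point: in the singular case the default (0, 0) makes the
   prediction 0, matched by [ind] = 0. Measurability is then visible, and [ind] is removed almost
   surely afterwards. *)
rewrite /tau_marg_pi (_ : (fun o => _) =
    (fun o => ind o *: (X *m wst + A o *m vst) + N o *m e)); last first.
  apply/funext => o /=; rewrite /N /ind.
  have [ZU|ZN] := boolP
  ((row_mx X (A o))^T *m row_mx X (A o) \in unitmx).
    rewrite unit_indic1// !scale1r wv1_hatE//=.
    rewrite [LHS](_ : _ = Lmx X (A o) *m response X wst vst (A o) e).
      by rewrite /response !mulmxDr !(mulmxA (Lmx _ _)) Lmx_mull// Lmx_mulr.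
    by rewrite [Lmx _ _]/Lmx mulmxDl !mulmxA.
  by rewrite unit_indic0// !scale0r mul0mx wv1_hat_singular// !mulmx0 addr0.
apply: ae_eq_expect_mx.
- by apply: measurable_mxD => //; exact: measurable_mxZ.
- exact: measurable_mxD.
- by apply: filterS hXA => o ZU; rewrite /ind unit_indic1// scale1r.
Qed.

Lemma sqnorm_expect_Lmx :
  sqnorm (expect_mx P (fun o => Lmx X (A o))) <= (d + m)%:R.
Proof.
rewrite -expect_mx_N.
have iN2 i j : integ (fun o => N o i j ^+ 2).
  apply: (@le_integ _ _ _ _ _ (fun=> (1 + (d + m)%:R) ^+ 2)) => [||].
  - by apply: measurable_funX; exact: mN.
  - move=> o; rewrite normrX ler_sqr ?nnegrE ?addr_ge0//.
    by rewrite (le_trans (normr_le_sqnorm (N o) i j))// lerD2l.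
  - exact: integ_cst.
rewrite -[leRHS](Rexp_cst P).
(* Jensen is applied entry by entry, then the pointwise bound on ||N||^2 is integrated. *)
apply: (@le_trans _ _ (\int[P]_o sqnorm (N o))%R).
  under eq_Rintegral do rewrite sqnormE.
  rewrite sqnormE Rexp_sum => [|i]; last exact: integ_sum.
  apply: ler_sum => i _; rewrite Rexp_sum//; apply: ler_sum => j _.
  by rewrite expect_mxE; exact: sqr_Rexp_le.
apply: le_Rintegral => //.
- by under eq_fun do rewrite sqnormE; apply: integ_sum => i; exact: integ_sum.
- exact: integ_cst.
Qed.

(** By Pythagoras the numerator is 2 ||Pi_x A||^2 plus the denominator, and the denominator is
    almost surely positive. The expectation stays in the extended reals, as it may be infinite. *)
Lemma expectation_PI_ratio_ge1 : (0 < m)%N ->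
  (1 <= 'E_P[fun o => ((sqnorm (proj_col X *m A o) + sqnorm (A o)) /
                       sqnorm ((1%:M - proj_col X) *m A o))%R])%E.
Proof.
move=> m0; rewrite -[leLHS](expectation_cst P).
have mA := measurable_mx_PI.
have mC k l (M : 'M[R]_(k, l)) := @measurable_mx_cst _ _ Omega _ _ M.
apply: expectation_le => //.
- apply: measurable_funM.
    apply: measurable_funD; last exact: measurable_sqnorm.
    by apply: measurable_sqnorm; exact: measurable_mxM.
  by apply: measurable_invr; apply: measurable_sqnorm; exact: measurable_mxM.
- by move=> o; rewrite divr_ge0 ?addr_ge0 ?sqnorm_ge0.
apply: filterS hXA => o ZU; rewrite -/(resid X (A o)).
have XU := gram_row_mxl ZU.
have r0 : 0 < sqnorm (resid X (A o)).
  rewrite lt_def sqnorm_ge0 andbT sqnorm_eq0; apply/eqP => r0.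
  (* A zero residual would send the all-ones vector to 0, although this vector is nonzero for m >
     0. *)
  have /gram_unitP/(_ (const_mx 1)) := resid_gram_unit ZU.
  rewrite r0 mul0mx => /(_ erefl)/matrixP/(_ (Ordinal m0) 0)/eqP.
  by rewrite !mxE oner_eq0.
rewrite /= ler_pdivlMr// mul1r (sqnorm_split XU (A o)).
by rewrite addrA lerDr addr_ge0 ?sqnorm_ge0.
Qed.

End Risk.

Theorem propositionI2 (R : realType) (dO : measure_display)
    (Omega : measurableType dO) (P : probability Omega R)
    (n d m : nat) (hn : (0 < n)%N) (hd : (0 < d)%N) (hm : (0 < m)%N)
    (sigma : R) (hsigma : 0 < sigma)
    (wst : 'cV[R]_d) (vst : 'cV[R]_m)
    (mu : 'cV[R]_d -> 'cV[R]_m) (Sigma : 'cV[R]_d -> 'M[R]_m)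
    (hSigma : forall x, sym_psd (Sigma x))
    (X : 'M[R]_(n, d))
    (A : Omega -> 'M[R]_(n, m)) (eps : Omega -> 'cV[R]_n)
    (hA : forall i : 'I_n, gaussian_vector P (fun o => (row i (A o))^T)
            (mu (row i X)^T) (Sigma (row i X)^T))
    (hArows : rows_independent P A)
    (heps : gaussian_vector P eps 0 ((sigma ^+ 2)%:M))
    (hindep : independent_mx P A eps)
    (hX : X^T *m X \in unitmx)
    (hAinv : {ae P, forall o, (A o)^T *m A o \in unitmx})
    (hXAinv : {ae P, forall o,
                (row_mx X (A o))^T *m row_mx X (A o) \in unitmx}) :
  let ER_nopi := expected_risk P X wst vst A eps
                   (tau_marg_nopi P X wst vst A) in
  let ER_pi := expected_risk P X wst vst A eps
                 (tau_marg_pi P X wst vst A) in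
  let bias2 := n%:R^-1 * sqnorm ((1%:M - proj_col X) *m mean_mx mu X *m vst) in
  ((ER_nopi > ER_pi)%E <->
     bias2 + sigma ^+ 2 * d%:R / n%:R >
     sigma ^+ 2 / n%:R * sqnorm (expect_mx P (fun o => Lmx X (A o)))) /\
  (m = 1%N ->
     (bias2%:E >
       (2 * sigma ^+ 2 / n%:R)%:E *
         'E_P[fun o => ((sqnorm (proj_col X *m A o) + sqnorm (A o)) /
                        sqnorm ((1%:M - proj_col X) *m A o))%R] +
       (sigma ^+ 2 * d%:R / n%:R)%:E)%E ->
     (ER_nopi > ER_pi)%E).
Proof.
move=> ER_nopi ER_pi bias2.
set S := sqnorm (expect_mx P _).
pose K := noise_floor P X wst vst mu A eps; pose q : R := n%:R^-1.
have q0 : 0 < q by rewrite invr_gt0 ltr0n.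
have nopiE : ER_nopi = (q * K + bias2 + sigma ^+ 2 * d%:R * q)%:E.
  rewrite /ER_nopi (expected_risk_affine wst vst hSigma hA heps
    (tau_marg_nopiE wst vst hSigma hA hX)).
  (* The X w* terms cancel, leaving the bias (I - Pi_x) mu(X) v*. *)
  rewrite opprD addrACA subrr add0r -{1}[_ *m vst]mul1mx -mulmxBl mulmxA.
  by rewrite sqnorm_proj_col// /bias2 -/K -/q !mulrDr addrA [q * (_ * _)]mulrC.
have piE : ER_pi = (q * K + sigma ^+ 2 * q * S)%:E.
  rewrite /ER_pi (expected_risk_affine wst vst hSigma hA heps
    (tau_marg_piE wst vst hSigma hA hXAinv)).
  rewrite subrr (_ : sqnorm 0 = 0) ?add0r; last by apply/eqP; rewrite sqnorm_eq0.
  by rewrite -/K -/q -/S mulrDr mulrCA mulrA.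
have main : (ER_nopi > ER_pi)%E <->
    bias2 + sigma ^+ 2 * d%:R * q > sigma ^+ 2 * q * S.
  by rewrite nopiE piE lte_fin -addrA ltrD2l.
split=> // m1 hbias; apply/main.
have SLe : S <= d%:R + 1.
  have := sqnorm_expect_Lmx hA hXAinv.
  by rewrite {2}m1 natrD.
have ratio := expectation_PI_ratio_ge1 hA hXAinv hm.
have s2q : 0 < sigma ^+ 2 * q by rewrite mulr_gt0// exprn_gt0.
(* The expected ratio is replaced by its lower bound 1. Then S <= d + 1 gives sigma^2 q S <= sigma^2
   q (d + 1), which is below [bias2]. *)
have : bias2 > 2 * sigma ^+ 2 * q + sigma ^+ 2 * d%:R * q.
  rewrite -lte_fin; apply: le_lt_trans hbias.
  rewrite EFinD leeD2r// -[leLHS]mule1 lee_pmul2l//.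
  by rewrite lte_fin -mulrA mulr_gt0.
have : sigma ^+ 2 * q * S <= sigma ^+ 2 * q * (d%:R + 1) by rewrite ler_pM2l.
have : 0 <= sigma ^+ 2 * q * d%:R by rewrite mulr_ge0 ?ler0n// ltW.
lra.
Qed.
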